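(* Let $A\in\mathbb{R}^{n\times n}$ and $B\in\mathbb{R}^{n\times p}$. The pair $(A,B)$ is controllable if and only if every monic polynomial of degree $n$ (with real coefficients) can be assigned to it.
   Context: The pair $(A,B)$ is called controllable if the system $x'=Ax+Bu$ is controllable: given $t_0<t_1$, for all $x_0,x_1\in\mathbb{R}^n$ there exists $u\in L^2((t_0,t_1);\mathbb{R}^p)$ such that the solution of $x'=Ax+Bu$ with $x(t_0)=x_0$ satisfies $x(t_1)=x_1$ (this does not depend on the choice of $t_0<t_1$; it is equivalent to $\operatorname{rank}[B,AB,\dots,A^{n-1}B]=n$). A monic polynomial $\chi$ of degree $n$ is assignable for (can be assigned to) the pair $(A,B)$ if there exists a matrix $F\in\mathbb{R}^{p\times n}$ such that $\chi_{A+BF}=\chi$, where $\chi_M(s)=\det(sI-M)$ denotes the characteristic polynomial of $M$. *)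

(* Defs.v *)
From HB Require Import structures.
From mathcomp Require Import all_boot all_order all_algebra.
From mathcomp Require Import all_classical all_reals all_analysis.

Set Implicit Arguments.
Unset Strict Implicit.
Unset Printing Implicit Defensive.

Import Order.TTheory GRing.Theory Num.Theory.
Import numFieldNormedType.Exports.

Local Open Scope classical_set_scope.
Local Open Scope ring_scope.

(* L^2((t0,t1); R^p), without quotienting by a.e. equality; values of u outside
   the open interval are irrelevant. *)
Definition square_integrable (R : realType) (p : nat) (t0 t1 : R)
    (u : R -> 'cV[R]_p) : Prop :=
  (forall k : 'I_p, measurable_fun `]t0, t1[ (fun t => u t k 0)) /\
  (@lebesgue_measure R).-integrable `]t0, t1[
    (fun t => (\sum_(k < p) u t k 0 ^+ 2)%:E).

(* Since u is only L^2, x' = A x + B u is understood in the sense of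
   Caratheodory: x is a continuous solution on [t0,t1] of
   x(t) = x0 + int_t0^t (A x(s) + B u(s)) ds.  Continuity of x makes the
   integrand Lebesgue integrable whenever u is L^2, so that Rintegral never
   takes its default value. *)
Definition is_solution (R : realType) (n p : nat)
    (A : 'M[R]_n) (B : 'M[R]_(n, p)) (t0 t1 : R)
    (u : R -> 'cV[R]_p) (x0 : 'cV[R]_n) (x : R -> 'cV[R]_n) : Prop :=
  (forall i : 'I_n, {within `[t0, t1], continuous (fun t => x t i 0)}) /\
  (forall t : R, t0 <= t <= t1 -> forall i : 'I_n,
    x t i 0 = x0 i 0 + Rintegral (@lebesgue_measure R) `[t0, t]
                         (fun s => (A *m x s + B *m u s) i 0)).

Definition controllable (R : realType) (n p : nat)
    (A : 'M[R]_n) (B : 'M[R]_(n, p)) (t0 t1 : R) : Prop :=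
  forall x0 x1 : 'cV[R]_n,
  exists u : R -> 'cV[R]_p, square_integrable t0 t1 u /\
  exists x : R -> 'cV[R]_n, is_solution A B t0 t1 u x0 x /\ x t1 = x1.

Definition assignable (R : realType) (n p : nat)
    (A : 'M[R]_n) (B : 'M[R]_(n, p)) (chi : {poly R}) : Prop :=
  exists F : 'M[R]_(p, n), char_poly (A + B *m F) = chi.

(* Main.v *)
(* Controllability is compared with the algebraic condition that no nonzero
   A-stable space of row vectors annihilates B.

   If P B = 0 and P A = D P, then z = P x solves z' = D z whatever the control,
   so z stays 0 when it starts from 0; thus a controllable pair satisfies the
   condition.  Under the condition, Heymann's lemma reduces pole placement to a
   single input, where Ackermann's formula gives the feedback.

   Conversely, assign X^n and (X - 1)^n.  The first feedback makes A + B K = N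
   nilpotent, and the second one then forces the condition.  For N nilpotent,
   N^(m+1) = 0, every polynomial h yields the trajectory
   x = sum_(k <= m) N^k B h^(m-k) of x' = N x + B h^(m+1), and Hermite
   interpolation of h at t0 and t1 gives x any prescribed endpoints. *)

Require Import Defs.
From HB Require Import structures.
From mathcomp Require Import all_boot all_order all_algebra.
From mathcomp Require Import all_classical all_reals all_analysis.
From mathcomp Require Import measurable_realfun ring lra.

Set Implicit Arguments.
Unset Strict Implicit.
Unset Printing Implicit Defensive.

Import Order.TTheory GRing.Theory Num.Theory.
Import numFieldNormedType.Exports.

Local Open Scope classical_set_scope.
Local Open Scope ring_scope.

(** * The algebraic controllability condition *)

(** A rank-free form of Kalman's criterion: [P *m A = D *m P] says that the row space of [P] is
    [A]-stable, and square [P] suffice, since every subspace of row vectors is the row space of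
    one. *)
Definition kalman (F : fieldType) (n p : nat) (A : 'M[F]_n) (B : 'M[F]_(n, p)) :=
  forall P D : 'M[F]_n, P *m B = 0 -> P *m A = D *m P -> P = 0.

(** Dual form of the condition: the rows of [kermx V^T] form the annihilator of [V], which is
    [A]-stable and kills [B], hence is zero. *)
Lemma kalman_row_full (F : fieldType) (n p m : nat) (A : 'M[F]_n)
    (B : 'M[F]_(n, p)) (V : 'M[F]_(m, n)) :
  kalman A B -> (B^T <= V)%MS -> (V *m A^T <= V)%MS -> row_full V.
Proof.
move=> kAB /submxP[X BX] /submxP[Y AY].
have KV : kermx V^T *m V^T = 0 by exact: mulmx_ker.
have K0 : kermx V^T = 0.
  have /submxP[D KA] : (kermx V^T *m A <= kermx V^T)%MS.
    apply/sub_kermxP; rewrite -mulmxA -[A]trmxK -trmx_mul AY trmx_mul mulmxA.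
    by rewrite KV mul0mx.
  apply: (kAB _ D) => //.
  by rewrite -[B]trmxK BX trmx_mul mulmxA KV mul0mx.
by rewrite /row_full -mxrank_tr -/(row_free _) -kermx_eq0 K0.
Qed.

(** * Heymann's lemma: reduction to a single input *)

Lemma row_free_inj0P (F : fieldType) (m n : nat) (X : 'M[F]_(m, n)) :
  row_free X <-> (forall c : 'rV_m, c *m X = 0 -> c = 0).
Proof.
split=> [fX c cX|h].
  by apply: (row_free_inj fX); rewrite cX mul0mx.
rewrite -kermx_eq0; apply/eqP/row_matrixP => i; rewrite row0; apply: h.
by rewrite -row_mul mulmx_ker row0.
Qed.

Lemma row_free_rcons (F : fieldType) (n k : nat) (x : nat -> 'rV[F]_n) :
  row_free (\matrix_(i < k) x i) ->
  ~~ (x k <= \matrix_(i < k) x i)%MS -> row_free (\matrix_(i < k.+1) x i).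
Proof.
move=> /row_free_inj0P free xk; apply/row_free_inj0P => c.
rewrite mulmx_sum_row big_ord_recr /= rowK => /eqP.
under eq_bigr do rewrite rowK /=.
pose d : 'rV_k := \row_i c 0 (widen_ord (leqnSn k) i).
have -> : \sum_(i < k) c 0 (widen_ord (leqnSn k) i) *: x i =
    d *m \matrix_(i < k) x i.
  by rewrite mulmx_sum_row; apply: eq_bigr => i _; rewrite rowK mxE.
move=> dc; have c0 : c 0 ord_max = 0.
  apply/eqP/negPn/negP => cn0; case/negP: xk.
  rewrite -(eqmx_scale _ cn0) -(addKr (d *m \matrix_(i < k) x i) (_ *: _)).
  by rewrite (eqP dc) addr0 -mulNmx submxMl.
move: dc; rewrite c0 scale0r addr0 => /eqP/free/rowP d0.
apply/rowP => i; rewrite mxE; case: (unliftP ord_max i) => [j ->|-> //].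
have := d0 j; rewrite !mxE => <-; congr (c 0 _).
by apply: val_inj; rewrite /= /bump leqNgt ltn_ord.
Qed.

(* Row vectors are used throughout the next lemmas: [a] and [b] are the
   transposes of [A] and [B].  The sequence extends because a span [V] containing
   every [x_k a + y b] would be [a]-stable and contain the rows of [b]. *)
Lemma heymann_sequence (F : fieldType) (n p : nat) (a : 'M[F]_n)
    (b : 'M[F]_(p, n)) :
  (forall V : 'M[F]_n, (b <= V)%MS -> (V *m a <= V)%MS -> row_full V) ->
  forall k, (k <= n)%N -> exists (x : nat -> 'rV[F]_n) (y : nat -> 'rV[F]_p),
    [/\ x 0%N = 0, forall i, (i < k)%N -> x i.+1 = x i *m a + y i *m b
      & row_free (\matrix_(i < k) x i.+1)].
Proof.
move=> full; elim=> [_|k IH kn].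
  exists (fun=> 0), (fun=> 0); split=> //.
  by rewrite /row_free flatmx0 mxrank0.
have [x [y [x0 xS free]]] := IH (ltnW kn).
pose X := \matrix_(i < k) x i.+1.
have [z zX] : exists z : 'rV_p, ~~ ((x k *m a + z *m b)%R <= X)%MS.
  have [//|/forallNP no_z] := pselect (exists z : 'rV_p, ~~ ((x k *m a + z *m b)%R <= X)%MS).
  have all_in (z : 'rV_p) : ((x k *m a + z *m b)%R <= X)%MS by apply/negPn/negP; exact: no_z.
  have xka : (x k *m a <= X)%MS by have := all_in 0; rewrite mul0mx addr0.
  have zb (z : 'rV_p) : (z *m b <= X)%MS.
    by rewrite -(addKr (x k *m a) (z *m b)) addmx_sub ?eqmx_opp.
  have xX i : (i < k)%N -> (x i.+1 <= X)%MS.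
    by move=> ik; rewrite -(rowK (fun i : 'I_k => x i.+1) (Ordinal ik)) row_sub.
  (* [X] has only [k] rows; [<<X>>] is a square matrix with the same row space, as [full]
     requires. *)
  have : row_full <<X>>%MS.
    apply: full; rewrite ?(eqmxMr _ (genmxE _)) !genmxE.
      by apply/row_subP => i; rewrite rowE zb.
    apply/row_subP => i; rewrite row_mul rowK.
    have [->//|ik] := eqVneq i.+1 k.
    have {}ik : (i.+1 < k)%N by rewrite ltn_neqAle ik ltn_ord.
    by rewrite -(addrK (y i.+1 *m b) (_ *m a)) -xS// addmx_sub ?xX ?eqmx_opp.
  rewrite /row_full genmxE => /eqP Xn.
  by have := rank_leq_row X; rewrite Xn leqNgt kn.
exists (fun i => if i == k.+1 then x k *m a + z *m b else x i).
exists (fun i => if i == k then z else y i); split=> //= [i|].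
  rewrite ltnS leq_eqVlt => /predU1P[->|ik].
    by rewrite !eqxx ltn_eqF.
  by rewrite eqSS (ltn_eqF ik) (ltn_eqF (ltnW ik : i < k.+1)%N) xS.
have XE : \matrix_(i < k) (if i.+1 == k.+1 then x k *m a + z *m b else x i.+1) = X.
  by apply/row_matrixP => i; rewrite !rowK eqSS ltn_eqF.
apply: (@row_free_rcons _ _ _ (fun i => if i.+1 == k.+1 then _ else x i.+1)).
  by rewrite XE.
by rewrite XE eqxx.
Qed.

(** The [x_(i+1)] form a basis, so some [c] sends each [x_(i+1)] to [y_(i+1)]. The recurrence then
    reads [x_(i+2) = x_(i+1) (a + c b)], and the basis is the orbit of [x_1 = y_0 b]. *)
Lemma heymann (F : fieldType) (n p : nat) (a : 'M[F]_n.+1)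
    (b : 'M[F]_(p, n.+1)) :
  (forall V : 'M[F]_n.+1, (b <= V)%MS -> (V *m a <= V)%MS -> row_full V) ->
  exists (y : 'rV[F]_p) (c : 'M[F]_(n.+1, p)),
    row_free (\matrix_(i < n.+1) (y *m b *m (a + c *m b) ^+ i)).
Proof.
move=> full; have [x [y [x0 xS free]]] := heymann_sequence full (leqnn _).
pose X := \matrix_(i < n.+1) x i.+1.
have uX : X \in unitmx by rewrite -row_free_unit.
exists (y 0%N), (invmx X *m \matrix_(i < n.+1) y i.+1).
set c := invmx X *m _.
have xc i : (i < n.+1)%N -> x i.+1 *m c = y i.+1.
  move=> ik; rewrite -(rowK (fun i : 'I_n.+1 => x i.+1) (Ordinal ik)) -row_mul.
  by rewrite mulmxA mulmxV// mul1mx rowK.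
have -> : \matrix_(i < n.+1) (y 0%N *m b *m (a + c *m b) ^+ i) = X; last by [].
apply/row_matrixP => -[i ik]; rewrite !rowK /=.
elim: i ik => [|i IH] ik; first by rewrite expr0 mulmx1 xS// x0 mul0mx add0r.
rewrite exprSr mulmxA IH; last exact: ltnW.
by rewrite mulmxDr mulmxA xc ?(ltnW ik)// -xS.
Qed.

(** * Ackermann's formula and pole placement *)

Lemma mulmx_horner_mx (F : comNzRingType) (n m k : nat) (M : 'M[F]_n.+1)
    (v : 'M[F]_(n.+1, m)) (q : {poly F}) : (size q <= k)%N ->
  horner_mx M q *m v = \sum_(i < k) q`_i *: (M ^+ i *m v).
Proof.
move=> sq; rewrite -{1}(coefK q) poly_def rmorph_sum mulmx_suml /=.
pose G i := q`_i *: (M ^+ i *m v).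
under eq_bigr => i _ do
  rewrite linearZ rmorphXn /= horner_mx_X -scalemxAl -/(G i).
rewrite (big_ord_widen k G sq) big_mkcond; apply: eq_bigr => i _ /=.
by rewrite /G; case: ltnP => // /(nth_default 0)->; rewrite scale0r.
Qed.

(* Ackermann's formula: [f = - chi(m) r], where [r] is the column with
   [x m^k r = 0] for [k < n] and [x m^n r = 1].  Then [N = m + f x] satisfies
   [N^k r = m^k r] for [k <= n], hence [chi(N) r = 0], and the independence of
   the [N^k r] identifies [chi] with the characteristic polynomial of [N]. *)
Lemma ackermann (F : fieldType) (n : nat) (m : 'M[F]_n.+1) (x : 'rV[F]_n.+1)
    (chi : {poly F}) :
  row_free (\matrix_(i < n.+1) (x *m m ^+ i)) -> chi \is monic ->
  size chi = n.+2 -> exists f : 'cV[F]_n.+1, char_poly (m + f *m x) = chi.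
Proof.
rewrite row_free_unit => uK mchi schi.
set K := \matrix_(i < n.+1) _ in uK.
pose r : 'cV_n.+1 := invmx K *m delta_mx ord_max 0.
have xr i : (i <= n)%N -> x *m m ^+ i *m r = (i == n)%:R%:M.
  move=> ik; rewrite -(rowK (fun i : 'I_n.+1 => x *m m ^+ i) (Ordinal (ik : i < n.+1)%N)).
  rewrite -/K -row_mul mulmxA mulmxV// mul1mx.
  by apply/matrixP => j1 j2; rewrite !mxE !ord1 /= andbT mulr1n.
pose f : 'cV_n.+1 := - (horner_mx m chi *m r).
exists f; set N := m + f *m x.
have Nr i : (i <= n)%N -> N ^+ i *m r = m ^+ i *m r.
  elim: i => [//|i IH] ik; rewrite exprS -mulmxA IH ?(ltnW ik)//.
  rewrite mulmxDl -[f *m x *m _]mulmxA [x *m _]mulmxA xr ?(ltnW ik)// ltn_eqF//.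
  by rewrite raddf0 mulmx0 addr0 mulmxA -[m *m m ^+ i]/(m * m ^+ i) -exprS.
have NSr : N ^+ n.+1 *m r = m ^+ n.+1 *m r + f.
  rewrite exprS -mulmxA Nr// mulmxDl -[f *m x *m _]mulmxA [x *m _]mulmxA xr//.
  by rewrite eqxx mulmx1 mulmxA -[m *m m ^+ n]/(m * m ^+ n) -exprS.
have chi1 : chi`_n.+1 = 1 by move/monicP: mchi; rewrite lead_coefE schi.
have chiN : horner_mx N chi *m r = 0.
  have chiE M : horner_mx M chi *m r =
      \sum_(i < n.+1) chi`_i *: (M ^+ i *m r) + M ^+ n.+1 *m r.
    rewrite (@mulmx_horner_mx _ _ _ n.+2) ?schi// big_ord_recr /=.
    by rewrite chi1 scale1r.
  rewrite (chiE N) NSr.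
  rewrite (eq_bigr (fun i : 'I_n.+1 => chi`_i *: (m ^+ i *m r))).
    by rewrite addrA -(chiE m) /f subrr.
  by move=> i _; rewrite Nr// -ltnS.
have mD i j : m ^+ i *m m ^+ j = m ^+ (i + j) by rewrite exprD.
have free (q : {poly F}) : (size q <= n.+1)%N -> horner_mx N q *m r = 0 -> q = 0.
  move=> sq; rewrite (mulmx_horner_mx _ _ sq).
  rewrite (eq_bigr (fun i : 'I_n.+1 => q`_i *: (m ^+ i *m r))); last first.
    by move=> i _; rewrite Nr// -ltnS.
  move=> q0; apply/eqP/negPn/negP => qn0.
  pose d := (size q).-1.
  have sd : size q = d.+1 by rewrite /d prednK// size_poly_gt0.
  have dn : (d <= n)%N by rewrite -ltnS -sd.
  (* With [d] the degree of [q], the row [x m^(n-d)] sends [m^i r] to 0 for [i < d] and to 1 for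
     [i = d]: only the leading coefficient of [q] survives. *)
  have := congr1 (fun v => x *m m ^+ (n - d) *m v) q0.
  rewrite mulmx0 mulmx_sumr (bigD1 (Ordinal (dn : d < n.+1)%N))//=.
  rewrite big1 => [|i]; last first.
    rewrite -val_eqE /= => id.
    rewrite -scalemxAr mulmxA -[x *m _ *m _]mulmxA mD.
    have [di|di] := ltnP d i.
      by rewrite nth_default ?scale0r// sd.
    have {id}di : (i < d)%N by rewrite ltn_neqAle id.
    have lt : (n - d + i < n)%N by rewrite -[ltnRHS](subnK dn) ltn_add2l.
    rewrite xr ?(ltnW lt)// (ltn_eqF lt).
    by rewrite raddf0 scaler0.
  rewrite addr0 -scalemxAr mulmxA -[x *m _ *m _]mulmxA mD subnK// xr// eqxx.
  rewrite scale_scalar_mx mulr1 => /matrixP/(_ 0 0); rewrite !mxE mulr1n.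
  by move/eqP; rewrite /d -lead_coefE lead_coef_eq0 (negPf qn0).
(* Both polynomials are monic of degree [n+1], so their difference is small enough for [free]. *)
apply/eqP; rewrite -subr_eq0; apply/eqP; apply: free; last first.
  by rewrite rmorphB /= mulmxBl Cayley_Hamilton chiN mul0mx subrr.
apply/leq_sizeP => j; rewrite leq_eqVlt => /predU1P[<-|nj]; rewrite coefB.
  rewrite chi1; have := monicP (char_poly_monic N).
  by rewrite lead_coefE size_char_poly => ->; rewrite subrr.
by rewrite !nth_default ?subrr ?size_char_poly ?schi.
Qed.

Lemma char_poly_tr (F : comNzRingType) (n : nat) (M : 'M[F]_n) :
  char_poly M^T = char_poly M.
Proof.
rewrite /char_poly -[RHS]det_tr; congr (\det _).
by rewrite /char_poly_mx linearB /= tr_scalar_mx map_trmx.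
Qed.

Lemma char_poly0 (F : comNzRingType) (M : 'M[F]_0) : char_poly M = 1.
Proof. by rewrite /char_poly det_mx00. Qed.

Lemma kalman_pole_placement (F : fieldType) (n p : nat) (A : 'M[F]_n)
    (B : 'M[F]_(n, p)) (chi : {poly F}) :
  kalman A B -> chi \is monic -> size chi = n.+1 ->
  exists K : 'M[F]_(p, n), char_poly (A + B *m K) = chi.
Proof.
case: n A B => [|n] A B kAB mchi schi.
  exists 0; rewrite char_poly0; move/eqP/size_poly1P : schi => [c _ chiE].
  by move/monicP: mchi; rewrite chiE lead_coefC => ->.
have full (V : 'M[F]_n.+1) : (B^T <= V)%MS -> (V *m A^T <= V)%MS -> row_full V.
  exact: kalman_row_full.
have [y [c free]] := heymann full.
have [f fE] := ackermann free mchi schi.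
(* The two feedbacks add up: [A^T + c B^T + f y B^T] is the transpose of [A + B (c + f y)^T]. *)
exists (c + f *m y)^T; rewrite -char_poly_tr -fE; congr char_poly.
by rewrite linearD /= trmx_mul trmxK mulmxDl addrA mulmxA.
Qed.

(** * Feedback invariance and the nilpotent case *)

(** Feedback does not change the action of [A] on row vectors that kill [B]. *)
Lemma kalman_feedback (F : fieldType) (n p : nat) (A : 'M[F]_n)
    (B : 'M[F]_(n, p)) (K : 'M[F]_(p, n)) :
  kalman A B -> kalman (A + B *m K) B.
Proof.
move=> kAB P D PB PA; apply: (kAB P D PB).
by rewrite -PA mulmxDr mulmxA PB mul0mx addr0.
Qed.

(* If [P] is a nonzero obstruction, so is the last nonzero [P A^j]; as it kills
   both [A] and [B], it also kills [A + B G]. *)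
Lemma kalman_of_nilpotent (F : fieldType) (n p : nat) (A : 'M[F]_n.+1)
    (B : 'M[F]_(n.+1, p)) (G : 'M[F]_(p, n.+1)) :
  A ^+ n.+1 = 0 -> A + B *m G \in unitmx -> kalman A B.
Proof.
move=> An uG P D PB PA.
have PX j : P *m A ^+ j = D ^+ j *m P.
  elim: j => [|j IH]; first by rewrite !expr0 mulmx1 mul1mx.
  by rewrite exprSr mulmxA IH -mulmxA PA mulmxA -[D ^+ j *m D]/(D ^+ j * D) -exprSr.
suff step j : P *m A ^+ j = 0 -> P = 0 by apply: (step n.+1); rewrite An mulmx0.
elim: j => [|j IH]; first by rewrite expr0 mulmx1.
rewrite exprSr mulmxA => Q0; apply: IH.
have QB : P *m A ^+ j *m B = 0 by rewrite PX -mulmxA PB mulmx0.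
by rewrite -[LHS](mulmxK uG) mulmxDr Q0 mulmxA QB mul0mx addr0 mul0mx.
Qed.

Lemma tr_expmx (F : comNzRingType) (n : nat) (M : 'M[F]_n) (k : nat) :
  M^T ^+ k = (M ^+ k)^T.
Proof.
elim: k => [|k IH]; first by rewrite !expr0 trmx1.
by rewrite exprS exprSr IH trmx_mul.
Qed.

(** The rows of the [B^T (N^T)^k], [k <= m], span a space containing those of [B^T]. It is
    [N^T]-stable because nilpotency ends the chain, so it is everything. *)
Lemma kalman_nilpotent_span (F : fieldType) (n p m : nat) (N : 'M[F]_n.+1)
    (B : 'M[F]_(n.+1, p)) (x : 'cV[F]_n.+1) :
  kalman N B -> N ^+ m.+1 = 0 ->
  exists c : 'I_m.+1 -> 'cV[F]_p, x = \sum_(k < m.+1) N ^+ k *m B *m c k.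
Proof.
move=> kNB Nn; pose Y k := B^T *m N^T ^+ k.
pose V := (\sum_(k < m.+1) <<Y k>>)%MS.
have YV (k : 'I_m.+1) : (Y k <= V)%MS by rewrite (sumsmx_sup k)// genmxE.
have fV : row_full V.
  apply: (kalman_row_full kNB).
    by have := YV ord0; rewrite /Y /= expr0 mulmx1.
  rewrite /V sumsmxMr; apply/sumsmx_subP => k _.
  rewrite (eqmxMr _ (genmxE _)) /Y -mulmxA -[N^T ^+ k *m N^T]/(N^T ^+ k * N^T).
  rewrite -exprSr; have [km|km] := ltnP k m.
    exact: (YV (Ordinal (km : k.+1 < m.+1)%N)).
  have -> : N^T ^+ k.+1 = 0.
    have -> : k.+1 = m.+1 by apply/eqP; rewrite eqSS eqn_leq km -ltnS ltn_ord.
    by rewrite tr_expmx Nn trmx0.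
  by rewrite mulmx0 sub0mx.
have /sub_sumsmxP[u xu] : (x^T <= V)%MS by exact: submx_full.
have /fin_all_exists[c uc] (k : 'I_m.+1) : exists c : 'rV_p, u k *m <<Y k>>%MS = c *m Y k.
  by apply/submxP; rewrite (submx_trans (submxMl _ _))// genmxE.
exists (fun k => (c k)^T); apply: trmx_inj; rewrite xu linear_sum /=.
apply: eq_bigr => k _; rewrite uc !trmx_mul trmxK /Y.
by rewrite tr_expmx.
Qed.

(** * Hermite interpolation *)

Lemma derivn_exp_XsubC (F : comNzRingType) (a : F) (m k : nat) :
  (('X - a%:P) ^+ m)^`(k) = ('X - a%:P) ^+ (m - k) *+ m ^_ k.
Proof.
elim: k => [|k IH]; first by rewrite derivn0 subn0 ffactn0.
rewrite derivnS IH derivMn deriv_exp derivXsubC mul1r -mulrnA subnS.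
by rewrite ffactnSr mulnC.
Qed.

(** Each derivative costs one factor [X - a] and changes the cofactor, hence an induction over all
    [q]. *)
Lemma derivn_mul_exp_XsubC (F : comNzRingType) (a : F) (q : {poly F})
    (m k : nat) : (k < m)%N -> (q * ('X - a%:P) ^+ m)^`(k).[a] = 0.
Proof.
elim: k m q => [|k IH] [|m] q //; rewrite ?ltnS => km.
  by rewrite derivn0 exprS !hornerM hornerXsubC subrr mul0r mulr0.
rewrite derivSn derivM deriv_exp derivXsubC mul1r /=.
have -> : q^`() * ('X - a%:P) ^+ m.+1 + q * (('X - a%:P) ^+ m *+ m.+1) =
    (q^`() * ('X - a%:P) + q *+ m.+1) * ('X - a%:P) ^+ m.
  by rewrite mulrDl exprS mulrA mulrnAr mulrnAl.
exact: IH.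
Qed.

Lemma taylor_interpolation (F : numFieldType) (a : F) (b : nat -> F) (m : nat) :
  exists T : {poly F}, forall k, (k < m)%N -> T^`(k).[a] = b k.
Proof.
exists (\sum_(i < m) (b i / i`!%:R) *: ('X - a%:P) ^+ i) => k km.
rewrite linear_sum horner_sum (bigD1 (Ordinal km)) //= big1 => [|i].
  rewrite derivnZ derivn_exp_XsubC subnn ffactnn expr0 hornerZ hornerMn hornerC.
  by rewrite addr0 divfK// pnatr_eq0 -lt0n fact_gt0.
rewrite -val_eqE /= => ik; rewrite derivnZ derivn_exp_XsubC hornerZ hornerMn.
have [lt_ik|le_ki] := ltnP i k; first by rewrite ffact_small// mulr0n mulr0.
have [j ->] : exists j, (i - k = j.+1)%N.
  by exists (i - k).-1; rewrite prednK// subn_gt0 ltn_neqAle eq_sym ik.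
by rewrite exprS !hornerM hornerXsubC subrr mul0r mul0rn mulr0.
Qed.

(** Chinese remaindering: [h] is congruent to one Taylor polynomial modulo [(X - s)^m] and to the
    other modulo [(X - t)^m]. Such multiples do not affect the first [m] derivatives at the node. *)
Lemma hermite_interpolation (F : numFieldType) (s t : F) (b c : nat -> F)
    (m : nat) : s != t ->
  exists h : {poly F},
    forall k, (k < m)%N -> h^`(k).[s] = b k /\ h^`(k).[t] = c k.
Proof.
move=> st; have [S Sb] := taylor_interpolation s b m.
have [T Tc] := taylor_interpolation t c m.
have /Bezout_eq1_coprimepP[[u v] /= uv1] :
    coprimep (('X - s%:P) ^+ m) (('X - t%:P) ^+ m).
  by rewrite coprimep_expl// coprimep_expr// coprimep_XsubC2// subr_eq0 eq_sym.
pose h := v * ('X - t%:P) ^+ m * S + u * ('X - s%:P) ^+ m * T.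
have hS : h = S + (u * (T - S)) * ('X - s%:P) ^+ m.
  by rewrite -[X in X + _]mul1r -uv1 /h; ring.
have hT : h = T + (v * (S - T)) * ('X - t%:P) ^+ m.
  by rewrite -[X in X + _]mul1r -uv1 /h; ring.
exists h => k km; split.
  by rewrite hS derivnD hornerD derivn_mul_exp_XsubC// addr0 Sb.
by rewrite hT derivnD hornerD derivn_mul_exp_XsubC// addr0 Tc.
Qed.

(** * Integration, and uniqueness for linear differential equations *)

Lemma lincomb_integrable d (T : measurableType d) (R : realType)
    (mu : {measure set T -> \bar R}) (D : set T) (I : Type) (s : seq I)
    (c : I -> R) (f : I -> T -> R) :
  (forall j, mu.-integrable D (EFin \o f j)) -> measurable D ->
  mu.-integrable D (EFin \o (fun t => \sum_(j <- s) c j * f j t)) /\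
  \int[mu]_(t in D) (\sum_(j <- s) c j * f j t) =
    \sum_(j <- s) c j * \int[mu]_(t in D) f j t.
Proof.
move=> intf mD.
have intcf j : mu.-integrable D (EFin \o (fun t => c j * f j t)).
  by under [X in mu.-integrable D X]eq_fun do rewrite /= EFinM; exact: (integrableZl mD (c j) (intf j)).
elim: s => [|j s [IHi IHe]].
  under [X in mu.-integrable D X]eq_fun do rewrite /= big_nil.
  under eq_Rintegral do rewrite big_nil.
  by rewrite big_nil Rintegral_cst// mul0r; split=> //; exact: integrable0.
under [X in mu.-integrable D X]eq_fun do rewrite /= big_cons.
under eq_Rintegral do rewrite big_cons.
split; first exact: (integrableD mD (intcf j) IHi).
by rewrite RintegralD// IHe RintegralZl// big_cons.
Qed.

Lemma within_continuous_lincomb (R : realType) (D : set R) (n : nat)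
    (c : 'I_n -> R) (f : 'I_n -> R -> R) :
  (forall j, {within D, continuous (f j)}) ->
  {within D, continuous (fun t => \sum_j c j * f j t)}.
Proof.
move=> cf.
have -> : (fun t => \sum_j c j * f j t) = \sum_j (fun t => c j * f j t).
  by rewrite fct_sumE.
elim/big_ind: _ => [|g h cg ch|j _] t; first exact: cvg_cst.
  by apply: cvgD; [exact: cg|exact: ch].
by apply: cvgM; [exact: cvg_cst|exact: cf].
Qed.

Lemma Rintegral_horner_deriv (R : realType) (q : {poly R}) (s t : R) :
  s <= t ->
  \int[@lebesgue_measure R]_(r in `[s, t]) q^`().[r] = q.[t] - q.[s].
Proof.
have cq (q' : {poly R}) : continuous (horner q') by exact: continuous_horner.
rewrite le_eqVlt => /predU1P[<-|st].
  by rewrite set_itv1 Rintegral_set1 subrr.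
rewrite /Rintegral (@continuous_FTC2 _ _ (horner q))//.
- exact/continuous_subspaceT/cq.
- split; first by move=> r _; exact: derivable_horner.
  + exact/cvg_at_right_filter/cq.
  + exact/cvg_at_left_filter/cq.
- by move=> r _; rewrite -derivE.
Qed.


(* Energy method: [exp (- c t) |z t|^2] is nonincreasing when [c |z|^2] dominates
   the quadratic form [2 <D z, z>]. *)
Lemma linear_ode_eq0 (R : realType) (n : nat) (D : 'M[R]_n)
    (z : R -> 'cV[R]_n) (t0 t1 : R) : t0 < t1 ->
  (forall i, {within `[t0, t1], continuous (fun t => z t i 0)}) ->
  (forall t, t0 <= t <= t1 -> forall i,
    z t i 0 = \int[@lebesgue_measure R]_(s in `[t0, t]) (D *m z s) i 0) ->
  z t1 = 0.
Proof.
move=> lt01 cz intz.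
have DzE i s : (D *m z s) i 0 = \sum_j D i j * z s j 0 by rewrite mxE.
have cDz i : {within `[t0, t1], continuous (fun s => (D *m z s) i 0)}.
  have -> : (fun s => (D *m z s) i 0) = (fun s => \sum_j D i j * z s j 0).
    by apply/funext => s; rewrite DzE.
  exact: within_continuous_lincomb.
(* The integral equation upgrades continuity to differentiability: near [x], [z] is a primitive of a
   function continuous at [x]. *)
have dz i x : x \in `]t0, t1[ ->
    is_derive x 1 (fun t => z t i 0) ((D *m z x) i 0).
  move=> xin; have /andP[tx xt] : t0 < x < t1 by rewrite in_itv in xin.
  have cDzx : {for x, continuous (fun s => (D *m z s) i 0)}.
    by have /(continuous_within_itvP _ lt01)[+ _ _] := cDz i; apply.
  have iDz : (@lebesgue_measure R).-integrable `[t0, t1]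
      (EFin \o (fun s => (D *m z s) i 0)).
    by apply: continuous_compact_integrable => //; exact: segment_compact.
  have [dF F'] := continuous_FTC1_closed xt iDz tx cDzx.
  apply: (@near_eq_is_derive _ _ _
    (fun t => \int[@lebesgue_measure R]_(s in `[t0, t]) (D *m z s) i 0)).
    near=> t; rewrite -intz//; apply/andP; split; apply/ltW; near: t.
      exact: lt_nbhsr.
    exact: lt_nbhsl.
  by split=> //; rewrite -derive1E.
(* This [c] dominates the form termwise, because [|z_i z_j| <= |z|^2]. *)
pose c : R := \sum_i \sum_j 2 * `|D i j|.
pose E (t : R) : R := \sum_i z t i 0 ^+ 2.
have E0 : E t0 = 0.
  apply: big1 => i _.
  by rewrite intz ?lexx ?ltW// set_itv1 Rintegral_set1 expr0n.
have dE x : x \in `]t0, t1[ ->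
    is_derive x 1 E (\sum_i 2 * z x i 0 * (D *m z x) i 0).
  move=> xin.
  have -> : E = \sum_i (fun t => z t i 0) ^+ 2.
    by apply/funext => t; rewrite fct_sumE.
  by apply: is_derive_sum => i; have := is_deriveX 2 (dz i x xin).
have E'_le x : \sum_i 2 * z x i 0 * (D *m z x) i 0 <= c * E x.
  rewrite mulr_suml; apply: ler_sum => i _.
  rewrite DzE mulr_sumr mulr_suml; apply: ler_sum => j _.
  have le_E k : z x k 0 ^+ 2 <= E x.
    by rewrite /E (bigD1 k)//= lerDl sumr_ge0// => l _; exact: sqr_ge0.
  have zz : `|z x i 0 * z x j 0| <= E x.
    rewrite normrM; have := le_E i; have := le_E j.
    rewrite -(real_normK (num_real (z x i 0))) -(real_normK (num_real (z x j 0))).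
    have := sqr_ge0 (`|z x i 0| - `|z x j 0|); nra.
  have -> : 2 * z x i 0 * (D i j * z x j 0) = 2 * (D i j * (z x i 0 * z x j 0)) by ring.
  rewrite -mulrA ler_pM2l//; apply: (le_trans (ler_norm _)).
  by rewrite normrM ler_wpM2l.
pose g (t : R) : R := expR (- c * t) * E t.
have dg x : x \in `]t0, t1[ -> is_derive x 1 g
    (expR (- c * x) * (\sum_i 2 * z x i 0 * (D *m z x) i 0 - c * E x)).
  move=> xin.
  have de : is_derive x 1 (fun t => expR (- c * t)) (expR (- c * x) * (- c)).
    apply: (@is_derive1_comp _ expR (fun t => - c * t)).
    have := is_deriveZ (- c) (is_derive_id x (1 : R)).
    by rewrite /GRing.scale /= mulr1.
  apply: (is_derive_eq (is_deriveM de (dE x xin))); rewrite /GRing.scale /=; ring.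
have : g t1 <= g t0.
  apply: (@ler0_derive1_le_cc _ g t0 t1) => //.
  - by move=> x /dg[].
  - move=> x xin; rewrite derive1E; have [_ ->] := dg x xin.
    by rewrite pmulr_rle0 ?expR_gt0// subr_le0.
  - move=> t; apply: cvgM.
      apply: continuous_subspaceT => {}t.
      by apply: cvg_comp; [apply: cvgM; [exact: cvg_cst|exact: cvg_id]|exact: continuous_expR].
    have -> : E = (fun t => \sum_i 1 * (z t i 0 ^+ 2)).
      by apply/funext => r; apply: eq_bigr => i _; rewrite mul1r.
    apply: (@within_continuous_lincomb _ _ _ (fun=> 1) (fun i t => z t i 0 ^+ 2)).
    by move=> i r; apply: (cvgM (cz i r) (cz i r)).
  - by rewrite in_itv/= lexx ltW.
  - by rewrite in_itv/= lexx ltW.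
  - exact: ltW.
rewrite /g E0 mulr0 pmulr_rle0 ?expR_gt0// => E1.
have Ei i : 0 <= z t1 i 0 ^+ 2 by exact: sqr_ge0.
apply/colP => i; rewrite mxE; apply/eqP; rewrite -sqrf_eq0 eq_le Ei andbT.
apply: le_trans E1; rewrite /E (bigD1 i)//= lerDl sumr_ge0//.
Unshelve. all: by end_near. Qed.

(** * Controllability implies the algebraic condition *)

(** On a bounded interval [L^2] lies in [L^1]: [|a| <= 1 + a^2], and constants are integrable. *)
Lemma square_integrable_coord (R : realType) (p : nat) (t0 t1 : R)
    (u : R -> 'cV[R]_p) (k : 'I_p) : square_integrable t0 t1 u ->
  (@lebesgue_measure R).-integrable `]t0, t1[ (EFin \o (fun t => u t k 0)).
Proof.
move=> [mu iu].
have i1 : (@lebesgue_measure R).-integrable `]t0, t1[ (EFin \o (fun=> 1)).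
  apply: (@integrableS _ _ _ (@lebesgue_measure R) `[t0, t1]%classic) => //; first exact: subset_itv_oo_cc.
  apply: continuous_compact_integrable; first exact: segment_compact.
  exact/continuous_subspaceT/cst_continuous.
have i1u : (@lebesgue_measure R).-integrable `]t0, t1[
    (fun t => (1 + \sum_(j < p) u t j 0 ^+ 2)%:E).
  under [X in integrable _ _ X]eq_fun do rewrite EFinD.
  exact: integrableD.
apply: (le_integrable _ _ _ i1u) => //; first by apply/measurable_EFinP; exact: mu.
move=> t _; rewrite /= lee_fin.
have le_u : u t k 0 ^+ 2 <= \sum_(j < p) u t j 0 ^+ 2.
  by rewrite (bigD1 k)//= lerDl sumr_ge0// => l _; exact: sqr_ge0.
have := real_normK (num_real (u t k 0)); set a := `|u t k 0| => aE.
have a2 := sqr_ge0 (a - 1).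
rewrite ger0_norm; nra.
Qed.

Lemma controllable_kalman (R : realType) (n p : nat) (A : 'M[R]_n)
    (B : 'M[R]_(n, p)) (t0 t1 : R) :
  t0 < t1 -> controllable A B t0 t1 -> kalman A B.
Proof.
move=> lt01 ctrl P D PB PA.
apply/matrixP => i j; pose e : 'cV[R]_n := delta_mx j 0.
suff : P *m e = 0.
  by move=> /(congr1 (fun v : 'cV_n => v i 0)); rewrite -colE !mxE.
(* Steering 0 to the basis vector [e] makes [P x] go from 0 to column [j] of [P]. *)
have [u [sq_u [x [[cx intx] <-]]]] := ctrl 0 e.
apply: (@linear_ode_eq0 _ _ D (fun t => P *m x t) t0 t1) => // [k|t tin k].
  have -> : (fun t => (P *m x t) k 0) = (fun t => \sum_l P k l * x t l 0).
    by apply/funext => t; rewrite mxE.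
  exact: within_continuous_lincomb.
have [t0t tt1] := andP tin.
pose f l s := (A *m x s + B *m u s) l 0.
have ix l : (@lebesgue_measure R).-integrable `]t0, t1[ (EFin \o (fun s => x s l 0)).
  apply: (@integrableS _ _ _ (@lebesgue_measure R) `[t0, t1]%classic) => //; first exact: subset_itv_oo_cc.
  by apply: continuous_compact_integrable; [exact: segment_compact|exact: cx].
have iu l := square_integrable_coord l sq_u.
have intf l : (@lebesgue_measure R).-integrable `]t0, t[ (EFin \o f l).
  apply: (@integrableS _ _ _ (@lebesgue_measure R) `]t0, t1[%classic) => //.
    by apply: subset_itvl; rewrite bnd_simp.
  have [iAx _] := lincomb_integrable (index_enum 'I_n) (A l) ix (measurable_itv _).
  have [iBu _] := lincomb_integrable (index_enum 'I_p) (B l) iu (measurable_itv _).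
  have -> : EFin \o f l = ((EFin \o (fun s => \sum_j A l j * x s j 0)%R) \+
      (EFin \o (fun s => \sum_j B l j * u s j 0)%R))%E.
    by apply/funext => s; rewrite /f /= !mxE EFinD.
  exact: integrableD.
(* Square integrability concerns the open interval while solutions integrate over a closed one; the
   endpoints are negligible. *)
have itvoo (h : R -> R) : (@lebesgue_measure R).-integrable `]t0, t[ (EFin \o h) ->
    \int[@lebesgue_measure R]_(s in `[t0, t]) h s =
    \int[@lebesgue_measure R]_(s in `]t0, t[) h s.
  move=> /(measurable_int (@lebesgue_measure R)) mh.
  by rewrite /Rintegral integral_itv_bndoo.
have [iPf intPf] := lincomb_integrable (index_enum 'I_n) (P k) intf
  (measurable_itv _).
(* Since [P B = 0], the control term can be added freely: [D P x = P A x = P (A x + B u)]. *)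
have DPx s : (D *m (P *m x s)) k 0 = \sum_l P k l * f l s.
  rewrite mulmxA -PA -mulmxA.
  have -> : P *m (A *m x s) = P *m (A *m x s + B *m u s).
    by rewrite mulmxDr [P *m (B *m _)]mulmxA PB mul0mx addr0.
  by rewrite mxE.
under eq_Rintegral do rewrite DPx.
rewrite itvoo// intPf mxE; apply: eq_bigr => l _.
by rewrite intx// mxE add0r; congr (_ * _); exact: (itvoo _ (intf l)).
Qed.

(** * Polynomial trajectories and steering *)

Lemma map_mx_horner_polyC (F : comNzRingType) (m n : nat) (t : F)
    (M : 'M[F]_(m, n)) : map_mx (horner_eval t) (map_mx polyC M) = M.
Proof. by apply/matrixP => i j; rewrite !mxE /horner_eval hornerC. Qed.

Lemma polynomial_solution (R : realType) (n p : nat) (A : 'M[R]_n)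
    (B : 'M[R]_(n, p)) (t0 t1 : R) (X : 'cV[{poly R}]_n) (U : 'cV[{poly R}]_p) :
  map_mx (@deriv R) X = map_mx polyC A *m X + map_mx polyC B *m U ->
  is_solution A B t0 t1 (fun t => map_mx (horner_eval t) U)
    (map_mx (horner_eval t0) X) (fun t => map_mx (horner_eval t) X).
Proof.
move=> X'; have cq (q : {poly R}) : continuous (horner q) by exact: continuous_horner.
split=> [i|t /andP[t0t _] i].
  have -> : (fun t => map_mx (horner_eval t) X i 0) = horner (X i 0).
    by apply/funext => t; rewrite mxE.
  exact/continuous_subspaceT/cq.
have rhs s : (A *m map_mx (horner_eval s) X + B *m map_mx (horner_eval s) U) i 0 =
    (X i 0)^`().[s].
  rewrite -{1}(map_mx_horner_polyC s A) -{1}(map_mx_horner_polyC s B).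
  rewrite -!map_mxM -map_mxD -X'.
  by rewrite !mxE.
under eq_Rintegral do rewrite rhs.
by rewrite Rintegral_horner_deriv// !mxE addrC subrK.
Qed.

Lemma polynomial_square_integrable (R : realType) (p : nat) (t0 t1 : R)
    (U : 'cV[{poly R}]_p) :
  square_integrable t0 t1 (fun t => map_mx (horner_eval t) U).
Proof.
have cq (q : {poly R}) : continuous (horner q) by exact: continuous_horner.
split=> [k|].
  have -> : (fun t => map_mx (horner_eval t) U k 0) = horner (U k 0).
    by apply/funext => t; rewrite mxE.
  apply: (measurable_funS measurableT) => //.
  exact: continuous_measurable_fun.
have -> : (fun t => (\sum_(k < p) map_mx (horner_eval t) U k 0 ^+ 2)%:E) =
    EFin \o horner (\sum_(k < p) U k 0 ^+ 2).
  apply/funext => t; rewrite /= horner_sum; congr EFin.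
  by apply: eq_bigr => k _; rewrite mxE horner_exp.
apply: (@integrableS _ _ _ (@lebesgue_measure R) `[t0, t1]%classic) => //.
  exact: subset_itv_oo_cc.
apply: continuous_compact_integrable; first exact: segment_compact.
exact/continuous_subspaceT/cq.
Qed.

(** Differentiation shifts the sum: term [k+1] of [X'] is [N] times term [k] of [X]. Term 0 of [X']
    gives the input, and [N] kills the last term of [X]. *)
Lemma nilpotent_flat_trajectory (F : comNzRingType) (n p m : nat) (N : 'M[F]_n)
    (B : 'M[F]_(n, p)) (H : 'cV[{poly F}]_p) :
  N ^+ m.+1 = 0 ->
  let X := \sum_(k < m.+1) map_mx polyC (N ^+ k *m B) *m map_mx (derivn (m - k)) H in
  map_mx (@deriv F) X =
    map_mx polyC N *m X + map_mx polyC B *m map_mx (derivn m.+1) H.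
Proof.
move=> Nm X; have derivC k (M : 'M[F]_(n, p)) (V : 'cV[{poly F}]_p) :
    map_mx (@deriv F) (map_mx polyC M *m map_mx (derivn k) V) =
    map_mx polyC M *m map_mx (derivn k.+1) V.
  apply/matrixP => i j; rewrite !mxE linear_sum; apply: eq_bigr => l _ /=.
  by rewrite !mxE derivM derivC mul0r add0r derivnS.
rewrite /X map_mx_sum mulmx_sumr big_ord_recl big_ord_recr /=.
rewrite mulmxA -map_mxM mulmxA -[N *m N ^+ m]/(N * N ^+ m) -exprS Nm mul0mx.
rewrite map_mx0 mul0mx addr0 addrC; congr (_ + _).
  apply: eq_bigr => k _; rewrite derivC mulmxA -map_mxM mulmxA.
  by rewrite -[N *m N ^+ k]/(N * N ^+ k) -exprS /bump /= subnSK.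
by rewrite derivC expr0 mul1mx subn0.
Qed.

Lemma nilpotent_feedback_controllable (R : realType) (n p : nat)
    (A : 'M[R]_n.+1) (B : 'M[R]_(n.+1, p)) (K : 'M[R]_(p, n.+1)) (t0 t1 : R) :
  t0 < t1 -> kalman A B -> (A + B *m K) ^+ n.+1 = 0 -> controllable A B t0 t1.
Proof.
move=> lt01 kAB Nn x0 x1; set N := A + B *m K in Nn.
have kNB : kalman N B by exact: kalman_feedback.
have [b x0E] := kalman_nilpotent_span x0 kNB Nn.
have [c x1E] := kalman_nilpotent_span x1 kNB Nn.
(* The order is reversed because [N^k B] multiplies the derivative of order [n - k]. *)
have /fin_all_exists[h hP] (j : 'I_p) : exists h : {poly R}, forall i, (i < n.+1)%N ->
    h^`(i).[t0] = b (inord (n - i)) j 0 /\ h^`(i).[t1] = c (inord (n - i)) j 0.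
  by apply: hermite_interpolation; rewrite lt_eqF.
pose H : 'cV[{poly R}]_p := \col_j h j.
pose X := \sum_(k < n.+1) map_mx polyC (N ^+ k *m B) *m map_mx (derivn (n - k)) H.
(* The feedback [K X] is put into the control, so that [A X + B U = N X + B H^(n+1)]. *)
pose U := map_mx polyC K *m X + map_mx (derivn n.+1) H.
have XE t (d : 'I_n.+1 -> 'cV[R]_p) :
    (forall j i, (i < n.+1)%N -> (h j)^`(i).[t] = d (inord (n - i)) j 0) ->
    map_mx (horner_eval t) X = \sum_(k < n.+1) N ^+ k *m B *m d k.
  move=> hd; rewrite map_mx_sum; apply: eq_bigr => k _; rewrite map_mxM.
  rewrite map_mx_horner_polyC; congr (_ *m _).
  apply/matrixP => i j; rewrite !mxE ord1 /= /horner_eval.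
  have kn : (k <= n)%N by rewrite -ltnS.
  by rewrite (hd _ (n - k)%N) ?ltnS ?leq_subr// (subKn kn) inord_val.
exists (fun t => map_mx (horner_eval t) U); split.
  exact: polynomial_square_integrable.
exists (fun t => map_mx (horner_eval t) X); split; last first.
  by rewrite x1E; apply: XE => j i /(hP j i)[].
have -> : x0 = map_mx (horner_eval t0) X.
  by rewrite x0E (XE _ b)// => j i /(hP j i)[].
apply: polynomial_solution; rewrite /X nilpotent_flat_trajectory// -/X.
by rewrite /U mulmxDr addrA [_ *m (_ *m X)]mulmxA -map_mxM -mulmxDl -map_mxD.
Qed.

Theorem theorem7p1 (R : realType) (n p : nat)
    (A : 'M[R]_n) (B : 'M[R]_(n, p)) (t0 t1 : R) (ht : t0 < t1) :
  controllable A B t0 t1 <->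
  (forall chi : {poly R}, chi \is monic -> size chi = n.+1 ->
     assignable A B chi).
Proof.
split=> [/(controllable_kalman ht) kAB chi|]; first exact: kalman_pole_placement.
(* In dimension 0 all states coincide, and the zero polynomials already give a solution. *)
case: n A B => [|n] A B assign.
  move=> x0 x1; exists (fun t => map_mx (horner_eval t) 0); split.
    exact: polynomial_square_integrable.
  exists (fun t => map_mx (horner_eval t) 0); split; last by rewrite [LHS]flatmx0 [RHS]flatmx0.
  rewrite [x0]flatmx0 -[X in is_solution _ _ _ _ _ X](flatmx0 (map_mx (horner_eval t0) 0)).
  by apply: polynomial_solution; rewrite [LHS]flatmx0 [RHS]flatmx0.
have [K NK] : assignable A B 'X^(n.+1).
  by apply: assign; rewrite ?monicXn ?size_polyXn.
have [G GE] : assignable A B (('X - 1%:P) ^+ n.+1).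
  by apply: assign; rewrite ?monic_exp ?monicXsubC// size_exp_XsubC.
have Nn : (A + B *m K) ^+ n.+1 = 0.
  by have := Cayley_Hamilton (A + B *m K); rewrite NK rmorphXn /= horner_mx_X.
apply: (nilpotent_feedback_controllable ht _ Nn).
have kNB : kalman (A + B *m K) B.
  (* Here [A + B K + B (G - K) = A + B G], which is invertible: up to sign its determinant is the
     value of [(X - 1)^(n+1)] at 0. *)
  apply: (kalman_of_nilpotent (G := G - K)) => //.
  rewrite mulmxBr addrA addrAC addrK unitmxE.
  have := char_poly_det (A + B *m G); rewrite GE -horner_coef0 horner_exp.
  rewrite hornerXsubC sub0r; set e := (-1) ^+ n.+1.
  have e0 : e != 0 by rewrite signr_eq0.
  by move=> eE; rewrite unitfE; apply/eqP => d0; move: e0; rewrite eE d0 mulr0 eqxx.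
(* The feedback [- K] brings the condition back to [A]. *)
have -> : A = A + B *m K + B *m (- K) by rewrite mulmxN addrK.
exact: kalman_feedback.
Qed.
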